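(* Let $t\ge 1$ be an integer. If $q$ is an integer with $2\cdot 4^t\le q\le 2\cdot 4^{t+1}-1$, then $$\gamma^{ID}(K_q^3)\le q^2-4^{t-1}.$$
   Context: $K_q^3=K_q\square K_q\square K_q$ is the graph with vertex set $\{(x,y,z)\in\mathbb{Z}^3\mid 1\le x,y,z\le q\}$ in which two distinct vertices are adjacent iff they differ in exactly one coordinate. $N[v]$ is the closed neighbourhood of $v$; a code is a nonempty set $C$ of vertices; $I(u)=N[u]\cap C$. A code $C$ is identifying in a graph if $I(u)\ne\emptyset$ for every vertex $u$ and $I(u)\neq I(v)$ for all distinct vertices $u,v$. $\gamma^{ID}(G)$ is the minimum cardinality of an identifying code in the finite graph $G$. *)

(* Defs.v *)
From mathcomp Require Import all_boot.

Set Implicit Arguments.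
Unset Strict Implicit.
Unset Printing Implicit Defensive.

(* A finite graph is its adjacency relation [e : rel T] on a finType [T]. *)

Definition closed_nbhd (T : finType) (e : rel T) (v : T) : {set T} :=
  [set u | (u == v) || e v u].

Definition Iset (T : finType) (e : rel T) (C : {set T}) (u : T) : {set T} :=
  closed_nbhd e u :&: C.

Definition identifying (T : finType) (e : rel T) (C : {set T}) : bool :=
  [&& C != set0,
      [forall u, Iset e C u != set0]
    & [forall u, forall v, (u != v) ==> (Iset e C u != Iset e C v)]].

(* [setT] is identifying as soon as some code is (see [gamma_IDP]), so it is a
   legitimate starting point for the minimum.  For a graph with no identifying
   code the value is #|T|. *)
Definition gamma_ID (T : finType) (e : rel T) : nat :=
  #|[arg min_(C < [set: T] | identifying e C) #|C|]|.

Lemma identifyingT (T : finType) (e : rel T) (C : {set T}) :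
  identifying e C -> identifying e [set: T].
Proof.
case/and3P=> /set0Pn[x _] _ /forallP sepC; apply/and3P; split.
- by apply/set0Pn; exists x.
- by apply/forallP=> u; apply/set0Pn; exists u; rewrite !inE eqxx.
apply/forallP=> u; apply/forallP=> v; apply/implyP=> neq_uv.
move/forallP/(_ v)/implyP/(_ neq_uv): (sepC u); apply: contraNneq.
by rewrite /Iset !setIT => ->.
Qed.

Lemma gamma_IDP (T : finType) (e : rel T) (C0 : {set T}) :
  identifying e C0 ->
  (exists2 C : {set T}, identifying e C & #|C| = gamma_ID e) /\
  (forall C : {set T}, identifying e C -> gamma_ID e <= #|C|).
Proof.
move/identifyingT=> idT; rewrite /gamma_ID.
by case: arg_minnP => // C idC minC; split=> //; exists C.
Qed.

(* The coordinates 1, ..., q are relabelled 0, ..., q-1. *)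
Definition K3_vertex (q : nat) : finType := ('I_q * 'I_q * 'I_q)%type.

Definition K3 (q : nat) : rel (K3_vertex q) :=
  fun u v =>
    (u.1.1 != v.1.1) + (u.1.2 != v.1.2) + (u.2 != v.2) == 1.

(* Main.v *)
Require Import Defs.
From mathcomp Require Import all_boot ssralg zmodp zify.

(** A Latin square of order q, seen as the set of triples (x, y, L x y), is an
    identifying code with q^2 words: every line of the grid holds exactly one
    word, so a non-word sees three words, one on each of its lines, and those
    three determine it, while a word sees itself only.  If this Latin square
    has subsquares, each subsquare may be exchanged for an identifying code of
    its own small grid, and every word saved in the small grid is saved in the
    large one ([gluing_identifying], [gluing_saving]).

    Call s a saving of a grid of side n when it has an identifying code with
    at most n^2 - s words.  Three facts give the bound.
    - The grid of side 4 has saving 1 ([saving4]).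
    - A saving s in side n gives a saving 4 s in side 4 n
      ([saving_quadruple]): cut the big grid by an idempotent Latin square of
      order 4 into blocks of side n and put a copy of the small code in each
      of the four diagonal blocks.
    - A saving s in side n persists in every side q >= 2 n ([saving_embed]),
      because a Latin square of order n can be prolonged to one of order q.

    Hence side 4^t has saving 4^(t-1), and so has every side q >= 2 * 4^t.

    Only the lines that meet a subsquare can lose their word.  A vertex u of
    such a line, outside the subsquare, then sees just two words, and exactly
    one other vertex v has both of them as neighbours.  What has to be
    prevented is that v is in the same situation; this is the condition
    [no_clash], and the reason why the order 4 square used for quadrupling is
    chosen anticommutative. *)

Set Implicit Arguments.
Unset Strict Implicit.
Unset Printing Implicit Defensive.

Import GRing.Theory.

(** * Grids and identification *)

(** Membership in a closed neighbourhood of the grid, as agreement in at least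
    two coordinates; in this form it is invariant under cyclic rotation of the
    coordinates, which is what the proofs exploit. *)
Definition near (T : eqType) (x y z a b c : T) : bool :=
  1 < (x == a) + (y == b) + (z == c).

Lemma nearP (T : eqType) (x y z a b c : T) :
  reflect [\/ x = a /\ y = b, y = b /\ z = c | z = c /\ x = a]
          (near x y z a b c).
Proof.
rewrite /near; apply: (iffP idP) => [|H]; last first.
  by case: H => -[-> ->]; rewrite !eqxx; do ?case: eqP.
case: (x =P a) => [->|_]; case: (y =P b) => [->|_];
  case: (z =P c) => [->|_] //= _;
  by [apply: Or31 | apply: Or32 | apply: Or33].
Qed.

Lemma near_rot (T : eqType) (x y z a b c : T) :
  near z x y c a b = near x y z a b c.
Proof. by rewrite /near -addnA addnC. Qed.

(** Codes and Latin squares are both ternary relations: a Latin square is the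
    graph of its table. *)
Definition rel3 (T : Type) := T -> T -> T -> bool.

Definition agree (T : eqType) (C : rel3 T) (x y z x' y' z' : T) :=
  forall a b c, C a b c -> near x y z a b c = near x' y' z' a b c.

Definition covers (T : eqType) (C : rel3 T) (x y z : T) :=
  exists a b c, C a b c /\ near x y z a b c.

Record identifying3 (T : eqType) (C : rel3 T) : Prop := Identifying3 {
  id3_cover : forall x y z, covers C x y z;
  id3_sep : forall x y z x' y' z',
    agree C x y z x' y' z' -> [/\ x = x', y = y' & z = z'] }.

Definition words (T : finType) (C : rel3 T) : {set T * T * T} :=
  [set u | C u.1.1 u.1.2 u.2].

(** The three directions of lines play the same role.  A condition on one
    direction is imposed on all of them by [cyc], and a lemma proved for one
    direction is transported to the others by rotating the relations. *)
Definition rot3 (T : Type) (C : rel3 T) : rel3 T := fun x y z => C z x y.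

Definition cyc (T : Type) (P : rel3 T -> Prop) (C : rel3 T) :=
  [/\ P C, P (rot3 C) & P (rot3 (rot3 C))].

Lemma cyc_rot3 (T : Type) (P : rel3 T -> Prop) (C : rel3 T) :
  cyc P C -> cyc P (rot3 C).
Proof. by case. Qed.

Lemma agree_rot3 (T : eqType) (C : rel3 T) x y z x' y' z' :
  agree C x y z x' y' z' -> agree (rot3 C) y z x y' z' x'.
Proof. by move=> H a b c /H; rewrite (near_rot y z x) (near_rot y'). Qed.

(** * Gluing codes into a Latin square with holes *)

(** The conditions below concern a partial equivalence [B] (being in the same
    block of coordinates), a Latin square [L] from which the subsquares living
    on the blocks have been removed, and the words [D] put into the resulting
    holes.  Each is written for one direction of lines. *)
Definition line_fill (T : eqType) (B : rel T) (L : rel3 T) :=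
  forall x y, ~~ B x y -> exists z, forall z', L x y z' = (z' == z).

Definition avoids (T : Type) (B : rel T) (L : rel3 T) :=
  forall x y z, L x y z -> ~~ B x y.

(** Let (x, y, z) lie on a line through a hole that has lost its word.  The
    words that it sees are (x, y', z) and (x', y, z), and the only other vertex
    next to both is (x', y', z).  If that one were on a line through a hole
    too, then the two vertices might not be separated. *)
Definition no_clash (T : Type) (B : rel T) (L : rel3 T) :=
  forall x y z x' y',
    L x y' z -> L x' y z -> B x y -> B x' y' -> False.

Definition inside (T : Type) (B : rel T) (D : rel3 T) :=
  forall x y z, D x y z -> B x y.

Record gluing (T : eqType) (B : rel T) (L D : rel3 T) : Prop := Gluing {
  glue_sym : symmetric B;
  glue_trans : transitive B;
  glue_fill : cyc (line_fill B) L;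
  glue_avoid : cyc (avoids B) L;
  glue_clash : cyc (no_clash B) L;
  glue_inside : cyc (inside B) D;
  glue_cover : forall x y z, B x y -> B y z -> covers D x y z;
  glue_sep : forall x y z x' y' z', B x y -> B y z -> B x' y' -> B y' z' ->
    B x x' -> agree D x y z x' y' z' -> [/\ x = x', y = y' & z = z'] }.

Definition union3 (T : Type) (L D : rel3 T) : rel3 T :=
  fun x y z => L x y z || D x y z.

(** * Glued codes are identifying *)
Section Glue.
Variables (T : finType) (B : rel T).
Implicit Types L D : rel3 T.

Lemma gluing_rot3 L D : gluing B L D -> gluing B (rot3 L) (rot3 D).
Proof.
case=> Bsym Btr fi av cl ins cov sep; split; try exact: cyc_rot3; try by [].
- move=> x y z Bxy Byz; have [||a [b [c [Dw nw]]]] := cov z x y.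
  + by rewrite Bsym (Btr y).
  + by [].
  by exists b, c, a; split; rewrite // -near_rot.
- move=> x y z x' y' z' Bxy Byz Bxy' Byz' Bxx' ag.
  have [||||||] // := sep z x y z' x' y'.
  + by rewrite Bsym (Btr y).
  + by rewrite Bsym (Btr y').
  + have Bzx : B z x by rewrite Bsym (Btr y).
    by apply: (Btr x) => //; apply: (Btr x') => //; apply: (Btr y').
  + by move=> a b c Dw; rewrite (near_rot x y z) (near_rot x'); apply: ag.
Qed.

Section Fix.
Variables L D : rel3 T.
Hypothesis G : gluing B L D.
Let C := union3 L D.

Lemma block_pair x y z a b c : B x y -> B y z -> near x y z a b c ->
  [\/ B a b, B b c | B c a].
Proof.
move=> Bxy Byz; have Bzx : B z x by rewrite (glue_sym G) (glue_trans G Bxy).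
by case/nearP=> -[<- <-]; [apply: Or31 | apply: Or32 | apply: Or33].
Qed.

(** This separates the vertices of a hole from all others: outside the hole
    there is always a word of [L] in sight. *)
Lemma L_not_near x y z a b c : B x y -> B y z -> L a b c ->
  near x y z a b c = false.
Proof.
move=> Bxy Byz Lw; apply/negP => /(block_pair Bxy Byz).
have [av1 av2 av3] := glue_avoid G.
by case; apply/negP; [apply: (av1 _ _ c) | apply: (av2 _ _ a)
  | apply: (av3 _ _ b)].
Qed.

Lemma union_off_block x y z : ~~ B x y -> C x y z = L x y z.
Proof.
move=> nB; rewrite /C /union3; case DD: (D x y z); last by rewrite orbF.
by have [/(_ x y z DD) BB _ _] := glue_inside G; rewrite BB in nB.
Qed.

Lemma line_word x y : ~~ B x y -> exists z, forall z', C x y z' = (z' == z).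
Proof.
move=> nB; have [/(_ x y nB)[z zP] _ _] := glue_fill G.
by exists z => z'; rewrite union_off_block.
Qed.

Lemma codeword_L x y z : C x y z -> ~~ (B x y && B y z) -> L x y z.
Proof.
case/orP=> // Dw; have [/(_ _ _ _ Dw) Bxy /(_ y z x Dw) Byz _] := glue_inside G.
by rewrite Bxy Byz.
Qed.

End Fix.

Lemma line_word23 L D y z : gluing B L D -> ~~ B y z ->
  exists x, forall x', union3 L D x' y z = (x' == x).
Proof. by move=> G; apply: (line_word (gluing_rot3 G)). Qed.

Lemma line_word31 L D z x : gluing B L D -> ~~ B z x ->
  exists y, forall y', union3 L D x y' z = (y' == y).
Proof. by move=> G; apply: (line_word (gluing_rot3 (gluing_rot3 G))). Qed.

(** Case of a word u and another vertex v on a line through u.  As that line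
    holds no other word, a word seen by v on one of its other lines is too far
    from u. *)
Lemma word_eq L D x y z x' y' z' : gluing B L D -> union3 L D x y z ->
  ~~ (B x y && B y z) -> agree (union3 L D) x y z x' y' z' ->
  x' = x -> y' = y -> z' = z.
Proof.
move=> G Cu nB ag ex ey; rewrite {}ex {}ey in ag.
have Lu := codeword_L G Cu nB.
have G1 := gluing_rot3 G; have G2 := gluing_rot3 G1.
have nBxy : ~~ B x y by case: (glue_avoid G) => /(_ _ _ _ Lu).
have [z0 z0P] := line_word G nBxy.
have := Cu; rewrite z0P => /eqP ez0; rewrite -{}ez0 in z0P.
apply/eqP/negPn/negP => nez.
have [Byz'|nByz'] := boolP (B y z').
  have nBzx : ~~ B z' x.
    apply: contra nBxy => Bzx.
    by rewrite (glue_sym G) (glue_trans G Byz').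
  have [w wP] := line_word31 G nBzx.
  have Cw : union3 L D x w z' by rewrite wP.
  have : near x y z x w z'.
    by rewrite (ag _ _ _ Cw); apply/nearP; apply: Or33.
  case/nearP=> -[e1 e2]; try by rewrite e2 eqxx in nez.
  - by move: Cw; rewrite -e2 z0P (negPf nez).
  - by rewrite e1 eqxx in nez.
have [w wP] := line_word23 G nByz'.
have Cw : union3 L D w y z' by rewrite wP.
have : near x y z w y z'.
  by rewrite (ag _ _ _ Cw); apply/nearP; apply: Or32.
case/nearP=> -[e1 e2]; try by rewrite e2 eqxx in nez.
- by move: Cw; rewrite -e1 z0P (negPf nez).
- by rewrite e1 eqxx in nez.
Qed.

Lemma sep_word L D x y z x' y' z' : gluing B L D -> union3 L D x y z ->
  ~~ (B x y && B y z) -> agree (union3 L D) x y z x' y' z' ->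
  [/\ x = x', y = y' & z = z'].
Proof.
move=> G Cu nB ag.
have G1 := gluing_rot3 G; have G2 := gluing_rot3 G1.
have Lu := codeword_L G Cu nB.
have [/(_ _ _ _ Lu) nBxy /(_ y z x) nByz /(_ z x y) nBzx] := glue_avoid G.
have : near x' y' z' x y z.
  by rewrite -(ag _ _ _ Cu); apply/nearP; apply: Or31.
case/nearP=> -[e1 e2].
- by rewrite e1 e2 (word_eq G Cu nB ag).
- rewrite e1 e2 (@word_eq _ _ y z x y' z' x' G1) //.
  + by rewrite negb_and nByz.
  + exact: agree_rot3.
- rewrite e1 e2 (@word_eq _ _ z x y z' x' y' G2) //.
  + by rewrite negb_and nBzx.
  + by apply: agree_rot3; apply: agree_rot3.
Qed.

(** A vertex u whose third line is empty: it is off the holes, so its two other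
    lines hold the words a and b, and a vertex agreeing with u is u itself or
    the fourth corner v of the rectangle u, a, b.  The third line of v is no
    line through a hole, by [no_clash], so it holds a word, which u does not
    see. *)
Lemma sep_empty_line L D x y z x' y' z' : gluing B L D ->
  ~~ (B x y && B y z) -> (forall c, ~~ union3 L D x y c) ->
  agree (union3 L D) x y z x' y' z' -> [/\ x = x', y = y' & z = z'].
Proof.
move=> G nB emp ag.
have G1 := gluing_rot3 G; have G2 := gluing_rot3 G1.
have Bxy : B x y.
  apply/negPn/negP => nBxy; have [c cP] := line_word G nBxy.
  by have := emp c; rewrite cP eqxx.
have nByz : ~~ B y z by rewrite Bxy in nB.
have nBzx : ~~ B z x.
  apply: contra nByz => Bzx.
  by rewrite (glue_sym G) (glue_trans G Bzx).
have [a aP] := line_word23 G nByz; have [b bP] := line_word31 G nBzx.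
have Ca : union3 L D a y z by rewrite aP.
have Cb : union3 L D x b z by rewrite bP.
have nax : a <> x by move=> e; have := emp z; rewrite -e Ca.
have nby : b <> y by move=> e; have := emp z; rewrite -e Cb.
have na : near x' y' z' a y z.
  by rewrite -(ag _ _ _ Ca); apply/nearP; apply: Or32.
have nb : near x' y' z' x b z.
  by rewrite -(ag _ _ _ Cb); apply/nearP; apply: Or33.
suff nopp : ~ (x' = a /\ y' = b).
  by case/nearP: na nb => -[e1 e2] /nearP[] [e3 e4]; split; try congruence;
     case: nopp; split; congruence.
case=> ex ey; have [Bab|nBab] := boolP (B a b).
  have [ncl _ _] := glue_clash G; apply: (ncl x y z a b) => //.
    by apply: (@codeword_L _ _ G2 z x b); rewrite // negb_and nBzx.
  by apply: (@codeword_L _ _ G1 y z a); rewrite // negb_and nByz.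
have [w wP] := line_word G nBab.
have Cw : union3 L D a b w by rewrite wP.
have : near x y z a b w.
  by rewrite (ag _ _ _ Cw) ex ey; apply/nearP; apply: Or31.
by case/nearP=> -[e1 e2]; congruence.
Qed.

Lemma off_block_rot L D x y z : gluing B L D ->
  ~~ (B x y && B y z) -> ~~ (B y z && B z x).
Proof.
move=> G; apply: contra => /andP[Byz Bzx].
by rewrite Byz (glue_sym G) (glue_trans G Byz).
Qed.

(** When no line through the vertex is empty and the vertex is not a word, one
    word on each of the three lines already determines it. *)
Lemma sep_off_block L D x y z x' y' z' : gluing B L D ->
  ~~ (B x y && B y z) -> agree (union3 L D) x y z x' y' z' ->
  [/\ x = x', y = y' & z = z'].
Proof.
move=> G nB ag; have G1 := gluing_rot3 G; have G2 := gluing_rot3 G1.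
have nB2 := off_block_rot G nB; have nB1 := off_block_rot G nB2.
have ag2 := agree_rot3 ag; have ag1 := agree_rot3 ag2.
have [Cu|nCu] := boolP (union3 L D x y z); first exact: (sep_word G Cu nB ag).
have [/existsP[c Cc]|] := boolP [exists c, union3 L D x y c]; last first.
  by rewrite negb_exists => /forallP emp; apply: sep_empty_line G nB emp ag.
have [/existsP[a Ca]|] := boolP [exists a, union3 L D a y z]; last first.
  rewrite negb_exists => /forallP emp.
  by have [] := sep_empty_line G1 nB2 emp ag2.
have [/existsP[b Cb]|] := boolP [exists b, union3 L D x b z]; last first.
  rewrite negb_exists => /forallP emp.
  by have [] := sep_empty_line G2 nB1 emp ag1.
have nax : a <> x by move=> e; rewrite -e Ca in nCu.
have nby : b <> y by move=> e; rewrite -e Cb in nCu.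
have ncz : c <> z by move=> e; rewrite -e Cc in nCu.
have na : near x' y' z' a y z.
  by rewrite -(ag _ _ _ Ca); apply/nearP; apply: Or32.
have nb : near x' y' z' x b z.
  by rewrite -(ag _ _ _ Cb); apply/nearP; apply: Or33.
have nc : near x' y' z' x y c.
  by rewrite -(ag _ _ _ Cc); apply/nearP; apply: Or31.
by case/nearP: na nb nc => -[e1 e2] /nearP[] [e3 e4] /nearP[] [e5 e6]; split;
   congruence.
Qed.

Lemma off_block_near L D x y z : gluing B L D -> ~~ (B x y && B y z) ->
  exists a b c, L a b c /\ near x y z a b c.
Proof.
move=> G; have [fi fi2 _] := glue_fill G; rewrite negb_and.
case/orP=> [/fi|/fi2] [w wP].
  by exists x, y, w; rewrite wP; split; last by apply/nearP; apply: Or31.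
exists w, y, z; split; last by apply/nearP; apply: Or32.
by rewrite -/(rot3 L y z w) wP.
Qed.

Lemma block_not_agree_off L D x y z x' y' z' : gluing B L D ->
  B x y -> B y z -> ~~ (B x' y' && B y' z') ->
  ~ agree (union3 L D) x y z x' y' z'.
Proof.
move=> G Bxy Byz nB' ag; have [a [b [c [Lw nw]]]] := off_block_near G nB'.
have := ag a b c; rewrite nw (L_not_near G Bxy Byz Lw) /union3 Lw.
by move/(_ isT).
Qed.

Lemma gluing_identifying L D : gluing B L D -> identifying3 (union3 L D).
Proof.
move=> G; split=> [x y z|x y z x' y' z' ag].
  have [/andP[Bxy Byz]|nB] := boolP (B x y && B y z).
    have [a [b [c [Dw nw]]]] := glue_cover G Bxy Byz.
    by exists a, b, c; rewrite /union3 Dw orbT.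
  have [a [b [c [Lw nw]]]] := off_block_near G nB.
  by exists a, b, c; rewrite /union3 Lw.
have [/andP[Bxy Byz]|nB] := boolP (B x y && B y z); last first.
  exact: sep_off_block G nB ag.
have [/andP[Bxy' Byz']|nB'] := boolP (B x' y' && B y' z'); last first.
  by case: (block_not_agree_off G Bxy Byz nB' ag).
have agD : agree D x y z x' y' z'.
  by move=> a b c Dw; apply: ag; rewrite /union3 Dw orbT.
apply: (glue_sep G) agD => //.
(* A vertex of one hole and a vertex of another share no coordinate, so they
   have no common neighbour; a word near both vertices puts them in one hole. *)
have [a [b [c [Dw nw]]]] := glue_cover G Bxy Byz.
have := ag a b c; rewrite nw /union3 Dw orbT => /(_ isT)/esym nw'.
have Bsym := glue_sym G; have Btr := glue_trans G.
have shared : [\/ x = x', y = y' | z = z'].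
  case/nearP: nw nw' => -[e1 e2] /nearP[] [e3 e4];
    by [apply: Or31; congruence | apply: Or32; congruence
       | apply: Or33; congruence].
case: shared => e.
- by rewrite -e; apply: (Btr y) => //; rewrite Bsym.
- by rewrite e in Bxy *; apply: (Btr y') => //; rewrite Bsym.
- rewrite e in Byz *; apply: (Btr y) => //; apply: (Btr z') => //.
  by rewrite Bsym; apply: Btr Byz'.
Qed.

End Glue.

(** A word of [L] is determined by its first two coordinates, and these are
    not in a common block. *)
Lemma card_gluing (T : finType) (B : rel T) (L D : rel3 T) : gluing B L D ->
  #|words (union3 L D)| + #|[set p : T * T | B p.1 p.2]|
    <= #|T| ^ 2 + #|words D|.
Proof.
move=> G; set P := [set p : T * T | _].
have leU : #|words (union3 L D)| <= #|words L| + #|words D|.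
  rewrite (leq_trans _ (leq_card_setU _ _)) ?leq_addr //.
  apply: subset_leq_card; apply/subsetP=> u; rewrite !inE.
  by case/orP=> ->; rewrite ?orbT.
have leL : #|words L| <= #|~: P|.
  pose f (u : T * T * T) := u.1.
  have f_inj : {in words L &, injective f}.
    move=> [[x y] z] [[x' y'] z']; rewrite !inE /f /= => Lu Lv [ex ey].
    rewrite -{}ex -{}ey in Lv *.
    have [/(_ _ _ _ Lu)nB _ _] := glue_avoid G.
    have [/(_ _ _ nB)[w wP] _ _] := glue_fill G.
    by move: Lu Lv; rewrite !wP => /eqP-> /eqP->.
  rewrite -(card_in_imset f_inj); apply: subset_leq_card.
  apply/subsetP=> p /imsetP[[[x y] z]]; rewrite inE /= => Lu ->.
  rewrite !inE /f /=; case: (glue_avoid G) => av _ _; exact: av Lu.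
have -> : #|T| ^ 2 = #|~: P| + #|P| by rewrite addnC cardsC card_prod.
by rewrite addnAC leq_add2r (leq_trans leU) // leq_add2r.
Qed.

(** * Savings *)

(** The count is relative to the size of the code of a Latin square.  Stated
    over an arbitrary finite type, so that the side of a grid can be built as
    a product or a sum of types. *)
Definition saving (T : finType) (s : nat) :=
  exists2 C : rel3 T, identifying3 C & #|words C| + s <= #|T| ^ 2.

Lemma near_inj (T T' : eqType) (g : T -> T') : injective g ->
  forall x y z a b c,
    near (g x) (g y) (g z) (g a) (g b) (g c) = near x y z a b c.
Proof. by move=> gI x y z a b c; rewrite /near !(inj_eq gI). Qed.

Lemma saving_bij (T T' : finType) s : #|T| = #|T'| -> saving T s -> saving T' s.
Proof.
move=> eTT' [C [cov sep] cardC].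
pose g (y : T') : T := enum_val (cast_ord (esym eTT') (enum_rank y)).
pose f (x : T) : T' := enum_val (cast_ord eTT' (enum_rank x)).
have fK : cancel f g.
  by move=> x; rewrite /g /f enum_valK cast_ordK enum_rankK.
have gK : cancel g f.
  by move=> x; rewrite /g /f enum_valK cast_ordKV enum_rankK.
have gI := can_inj gK.
exists (fun x y z => C (g x) (g y) (g z)).
  split=> [x y z|x y z x' y' z' ag].
    have [a [b [c [Cw nw]]]] := cov (g x) (g y) (g z).
    by exists (f a), (f b), (f c); rewrite -(near_inj gI) !fK.
  have [|/gI-> /gI-> /gI->] // := sep (g x) (g y) (g z) (g x') (g y') (g z').
  move=> a b c; rewrite -(fK a) -(fK b) -(fK c) !(near_inj gI); exact: ag.
rewrite -eTT' (leq_trans _ cardC) // leq_add2r.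
pose h (u : T' * T' * T') := (g u.1.1, g u.1.2, g u.2).
have hI : injective h.
  by move=> [[x y] z] [[x' y'] z'] [/gI-> /gI-> /gI->].
rewrite -(card_imset _ hI); apply: subset_leq_card.
by apply/subsetP=> w /imsetP[u]; rewrite !inE => Cu ->.
Qed.

Lemma in_closed_nbhd q (u v : K3_vertex q) :
  (v \in closed_nbhd (@K3 q) u) = near u.1.1 u.1.2 u.2 v.1.1 v.1.2 v.2.
Proof.
rewrite inE /K3 /near; case: u v => [[x y] z] [[a b] c] /=.
rewrite !xpair_eqE !(eq_sym a) !(eq_sym b) !(eq_sym c).
by case: eqP; case: eqP; case: eqP.
Qed.

Lemma saving_gamma q s : 0 < q ->
  saving 'I_q s -> gamma_ID (@K3 q) <= q ^ 2 - s.
Proof.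
case: q => // q _ [C [cov sep]]; rewrite card_ord => cardC.
suff idC : identifying (@K3 q.+1) (words C).
  have [_ /(_ _ idC) minC] := gamma_IDP idC.
  apply: leq_trans minC _; rewrite -(leq_add2r s) subnK //.
  exact: leq_trans (leq_addl _ _) cardC.
apply/and3P; split.
- have [a [b [c [Cw _]]]] := cov ord0 ord0 ord0.
  by apply/set0Pn; exists (a, b, c); rewrite inE.
- apply/forallP=> -[[x y] z]; have [a [b [c [Cw nw]]]] := cov x y z.
  by apply/set0Pn; exists (a, b, c); rewrite in_setI in_closed_nbhd inE Cw nw.
apply/forallP=> -[[x y] z]; apply/forallP=> -[[x' y'] z']; apply/implyP.
apply: contra_neq => /setP eqI; have [|-> -> ->] // := sep x y z x' y' z'.
move=> a b c Cw; have := eqI (a, b, c).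
by rewrite !in_setI !in_closed_nbhd inE Cw !andbT.
Qed.

(** [k] is the number of holes, [N] the number of words that a subsquare would
    have in a hole, [e] the number of words put there instead. *)
Lemma gluing_saving (T : finType) (B : rel T) (L D : rel3 T) k e N s :
  gluing B L D -> k * N <= #|[set p : T * T | B p.1 p.2]| ->
  #|words D| <= k * e -> e + s <= N -> saving T (k * s).
Proof.
move=> G leB leD leN; exists (union3 L D); first exact: gluing_identifying G.
have := card_gluing G; have := leq_mul (leqnn k) leN; rewrite mulnDr.
by move: leB leD; lia.
Qed.

(** * A code with 15 words in the grid of side 4 *)

(** As a square whose cell (x, y) lists the z with (x, y, z) in the code:
<<
      1    3    1    -
      0    -    3    0,1
      -    2,3  0    2
      2    0    1,3  -
>>
    It was found by computer search, and that it identifies is a finite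
    check. *)
Definition words4 : seq (nat * nat * nat) :=
  [:: (0, 0, 1); (0, 1, 3); (0, 2, 1); (1, 0, 0); (1, 2, 3); (1, 3, 0);
      (1, 3, 1); (2, 1, 2); (2, 1, 3); (2, 2, 0); (2, 3, 2); (3, 0, 2);
      (3, 1, 0); (3, 2, 1); (3, 2, 3)].

Definition all4 (P : nat -> nat -> nat -> bool) :=
  all (fun x => all (fun y => all (P x y) (iota 0 4)) (iota 0 4)) (iota 0 4).

Lemma all4P P : all4 P -> forall x y z : 'I_4, P x y z.
Proof.
have I4 (i : 'I_4) : (i : nat) \in iota 0 4 by rewrite mem_iota ltn_ord.
by move=> /allP H x y z; have /allP/(_ _ (I4 y))/allP := H x (I4 x); apply.
Qed.

Definition near_word x y z (w : nat * nat * nat) := near x y z w.1.1 w.1.2 w.2.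

Definition code4 : rel3 'I_4 := fun x y z => (val x, val y, val z) \in words4.

(** The checks are run on natural numbers, where they compute; this brings a
    witness back to the grid. *)
Lemma words4_lift w : w \in words4 -> exists a b c : 'I_4,
  code4 a b c /\ w = (val a, val b, val c).
Proof.
move=> Cw; have : all (fun w => (w.1.1 < 4) && (w.1.2 < 4) && (w.2 < 4)) words4.
  by [].
move/allP/(_ w Cw)=> /andP[/andP[la lb] lc].
exists (Ordinal la), (Ordinal lb), (Ordinal lc).
by rewrite /code4 /=; case: w Cw {la lb lc} => [[]].
Qed.

Lemma code4_cover_check :
  all4 (fun x y z => has (near_word x y z) words4).
Proof. by vm_compute. Qed.

Lemma code4_sep_check : all4 (fun x y z => all4 (fun x' y' z' =>
  (x == x') && (y == y') && (z == z') ||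
  has (fun w => near_word x y z w != near_word x' y' z' w) words4)).
Proof. by vm_compute. Qed.

Lemma saving4 : saving 'I_4 1.
Proof.
exists code4; first split=> [x y z|x y z x' y' z' ag].
- have /hasP[w] := all4P code4_cover_check x y z.
  move=> /words4_lift[a [b [c [Cw ->]]]] nw.
  by exists a, b, c.
- have := all4P (all4P code4_sep_check x y z) x' y' z'.
  case/orP=> [/andP[/andP[/eqP/val_inj-> /eqP/val_inj->] /eqP/val_inj->] //|].
  case/hasP=> w /words4_lift[a [b [c [Cw ->]]]] /eqP[]; exact: ag Cw.
rewrite card_ord -[_ ^ 2]/(size words4 + 1) leq_add2r cardE.
pose f (u : 'I_4 * 'I_4 * 'I_4) := (val u.1.1, val u.1.2, val u.2).
rewrite -(size_map f); apply: uniq_leq_size.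
  rewrite map_inj_uniq ?enum_uniq //.
  by move=> [[x y] z] [[x' y'] z'] [] /val_inj-> /val_inj-> /val_inj->.
by move=> w /mapP[u]; rewrite mem_enum inE => Cu ->.
Qed.

(** * Quadrupling the side *)

(** The pair (p, q) stands for p + q w in the field of order 4, where
    w^2 = w + 1. *)
Definition F4 := (bool * bool)%type.

(** The idempotent quasigroup a, b |-> w a + w^2 b. *)
Definition op4 (a b : F4) : F4 :=
  (a.2 (+) b.1 (+) b.2, a.1 (+) a.2 (+) b.1).

Definition tri4 (a b c : F4) := (a != b) && (op4 a b == c).

(** If c = w a + w^2 b then b = w c + w^2 a, because w^3 = 1 and the
    characteristic is 2. *)
Lemma tri4_rot a b c : tri4 c a b = tri4 a b c.
Proof. by case: a b c => [[] []] [[] []] [[] []]. Qed.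

(** Anticommutativity: w a + w^2 b = w b + w^2 a forces a = b, because
    w + w^2 = 1. *)
Lemma tri4_anti a b c d e : tri4 a b c -> tri4 d e c -> a = e -> d = b -> False.
Proof.
move=> + + ea ed; rewrite {}ea {}ed.
by case: e b c => [[] []] [[] []] [[] []].
Qed.

Section Quadruple.
Variables (n : nat) (E : rel3 'I_n.+1).
Hypothesis Eid : identifying3 E.
Let X := 'I_n.+1.
Let V := (F4 * X)%type.
Local Open Scope ring_scope.

Definition same_block (u v : V) := u.1 == v.1.

(** Off the diagonal blocks: the quasigroup chooses the block, and inside each
    block x + y + z = 0 is a Latin square invariant under rotation. *)
Definition quad_lines (u v w : V) :=
  tri4 u.1 v.1 w.1 && (u.2 + v.2 + w.2 == 0).

Definition quad_copies (u v w : V) :=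
  (u.1 == v.1) && (v.1 == w.1) && E u.2 v.2 w.2.

Lemma quad_rot u v w : quad_lines w u v = quad_lines u v w.
Proof. by rewrite /quad_lines tri4_rot -addrA addrC. Qed.

(** The rotations of an invariant relation are equal to it only pointwise,
    whence the quantification over [L']. *)
Lemma cyc_of_invariant (T : Type) (L : rel3 T) (P : rel3 T -> Prop) :
  (forall x y z, L z x y = L x y z) ->
  (forall L', (forall x y z, L' x y z = L x y z) -> P L') -> cyc P L.
Proof.
move=> Ls PL; split; apply: PL => x y z; first by [].
  exact: Ls.
exact: etrans (Ls z x y) (Ls x y z).
Qed.

Lemma quad_gluing : gluing same_block quad_lines quad_copies.
Proof.
split.
- by move=> u v; rewrite /same_block eq_sym.
- by move=> v u w /eqP eu /eqP ew; apply/eqP; rewrite eu.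
- apply: cyc_of_invariant quad_rot _ => L' LE [a x] [b y] nB.
  exists (op4 a b, - (x + y)) => -[c z]; rewrite LE /quad_lines /tri4.
  rewrite /same_block /= in nB *; rewrite nB /= eq_sym xpair_eqE.
  by rewrite addrC addr_eq0.
- apply: cyc_of_invariant quad_rot _ => L' LE u v w; rewrite LE.
  by case/andP=> /andP[].
- apply: cyc_of_invariant quad_rot _ => L' LE u v w u' v'; rewrite !LE.
  by case/andP=> t1 _ /andP[t2 _] /eqP e /eqP e'; apply: (tri4_anti t1 t2).
- split=> u v w /andP[/andP[/eqP e1 /eqP e2] _]; rewrite /same_block.
  + by rewrite e1.
  + by rewrite e2.
  + by rewrite -e2 -e1.
- move=> [a x] [b y] [c z] /eqP/= <- /eqP/= <-.
  have [x' [y' [z' [Ew nw]]]] := id3_cover Eid x y z.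
  exists (a, x'), (a, y'), (a, z'); rewrite /quad_copies /= !eqxx; split=> //.
  by rewrite near_inj // => ? ? [].
- move=> [a x] [b y] [c z] [a' x'] [b' y'] [c' z'].
  move=> /eqP/= <- /eqP/= <- /eqP/= <- /eqP/= <- /eqP/= <- ag.
  have [|-> -> ->] // := id3_sep Eid (x := x) (y := y) (z := z)
     (x' := x') (y' := y') (z' := z').
  move=> x0 y0 z0 Ew; have := ag (a, x0) (a, y0) (a, z0).
  rewrite !near_inj; try by move=> ? ? [].
  by rewrite /quad_copies /= !eqxx; apply.
Qed.

End Quadruple.

Lemma saving_quadruple n s : 0 < n ->
  saving 'I_n s -> saving 'I_(4 * n) (4 * s).
Proof.
case: n => // n _ [E Eid]; rewrite card_ord => cardE.
apply: (@saving_bij (F4 * 'I_n.+1)%type).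
  by rewrite !card_prod card_bool !card_ord.
apply: (gluing_saving (quad_gluing Eid) _ _ cardE).
  pose f (u : F4 * ('I_n.+1 * 'I_n.+1)) := ((u.1, u.2.1), (u.1, u.2.2)).
  have fI : injective f by move=> [a [x y]] [a' [x' y']] [-> -> _ ->].
  have -> : 4 * n.+1 ^ 2 = #|[set: F4 * ('I_n.+1 * 'I_n.+1)]|.
    by rewrite cardsT !card_prod card_bool !card_ord.
  rewrite -(card_imset _ fI); apply: subset_leq_card.
  by apply/subsetP=> w /imsetP[u _ ->]; rewrite inE /same_block.
pose f (u : F4 * ('I_n.+1 * 'I_n.+1 * 'I_n.+1)) :=
  ((u.1, u.2.1.1), (u.1, u.2.1.2), (u.1, u.2.2)).
have -> : 4 * #|words E| = #|setX [set: F4] (words E)|.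
  by rewrite cardsX cardsT card_prod card_bool.
apply: leq_trans (leq_imset_card f _); apply: subset_leq_card.
apply/subsetP=> -[[[a x] [b y]] [c z]]; rewrite inE /quad_copies /=.
case/andP=> /andP[/eqP<- /eqP<-] Ew; apply/imsetP.
by exists (a, (x, y, z)); rewrite // !inE.
Qed.

(** * Prolonging a code to a side at least twice as large *)

(** With k = w + 1, these are k - 1 cells (i, b i) of the addition table of
    Z/k, in distinct rows and columns and with distinct sums - c i; for k even
    no such set has k cells.  For i in the first half take b i = i, so that
    the sums run over the even numbers below k.  In the second half the sums
    must run over the odd ones: for k odd b i = i still works, since 2 i is
    reduced modulo k, and for k even b is shifted by one.  At the last index
    b and c take the values that are left over. *)
Lemma near_transversal w : exists b c : 'I_w.+1 -> 'I_w.+1,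
  [/\ injective b, injective c &
     forall i : 'I_w.+1, (i < w -> i + b i + c i = 0)%R].
Proof.
have := odd_double_half w; move: (odd w) (w./2) => p h' wE.
pose h := h'.+1.
pose bn i := if i < h then i else if i < w then i + p else if p then h else i.
pose sn i := if i < h then i.*2 else i.*2 + p - w.+1.
have bnlt i : i < w.+1 -> bn i < w.+1.
  by move: wE; rewrite /bn /h; case: (p) => /=; do !case: ifP => ?; lia.
have snlt i : i < w.+1 -> sn i < w.+1.
  by move: wE; rewrite /sn /h; case: (p) => /=; do !case: ifP => ?; lia.
exists (fun i => inord (bn i)), (fun i => - inord (sn i))%R; split.
- move=> i j /(congr1 val); rewrite /= !inordK ?bnlt // => e; apply: val_inj.
  have := ltn_ord i; have := ltn_ord j; move: e wE; rewrite /bn /h /=.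
  by case: (p) => /=; do !case: ifP => ?; lia.
- move=> i j /oppr_inj/(congr1 val); rewrite /= !inordK ?snlt // => e.
  apply: val_inj.
  have := ltn_ord i; have := ltn_ord j; move: e wE; rewrite /sn /h /=.
  by case: (p) => /=; do !case: ifP => ?; lia.
move=> i iw; apply/eqP; rewrite subr_eq0; apply/eqP/val_inj => /=.
rewrite !inordK ?bnlt ?snlt //.
have : i + bn i = sn i \/ i + bn i = sn i + w.+1.
  move: (ltn_ord i) iw wE; rewrite /bn /sn /h.
  by case: (p) => /=; do !case: ifP => ?; lia.
by case=> ->; rewrite ?modnDr modn_small ?snlt.
Qed.

Section Embed.
Variables (n w : nat).
Hypothesis nw : n <= w.+1.
Let X := 'I_n.
Let W := 'I_w.+1.
Let V := (X + W)%type.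
Local Open Scope ring_scope.

(** The indices in Z/k from k - n on are handed over to the n elements of
    [X]. *)
Definition hole (x : X) : W := inord (w.+1 - n + x).

Definition both_old (u v : V) :=
  match u, v with inl _, inl _ => true | _, _ => false end.

(** A Latin square on [X + W] with a hole on [X], developed by translations of
    W = Z/k.  A triple (u, v, t) of elements of [W] is described up to
    translation by its differences v - u, t - v and u - t, which add up to 0.
    The first k - n indices i use the difference triples (a i, b i, c i); each
    of the other indices belongs to some x of [X], and there the differences
    a i, b i and c i are used independently, for the triples in which x
    replaces the third, the first or the second element. *)
Definition prolong (a b c : W -> W) : rel3 V := fun u v t =>
  match u, v, t with
  | inr u, inr v, inr t => [exists i : W, [&& (i < w.+1 - n)%N, v - u == a i,
       t - v == b i & u - t == c i]]
  | inr u, inr v, inl x => v - u == a (hole x)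
  | inl x, inr v, inr t => t - v == b (hole x)
  | inr u, inl x, inr t => u - t == c (hole x)
  | _, _, _ => false
  end.

Lemma hole_val x : hole x = (w.+1 - n + x)%N :> nat.
Proof. by rewrite inordK //; have := ltn_ord x; lia. Qed.

Lemma hole_inj : injective hole.
Proof.
move=> x y /(congr1 val); rewrite /= !hole_val => /addnI; exact: val_inj.
Qed.

Lemma hole_or (i : W) : (i < w.+1 - n)%N \/ exists x, i = hole x.
Proof.
case: (ltnP i (w.+1 - n)) => [|le]; [by left | right].
have lt : (i - (w.+1 - n) < n)%N by have := ltn_ord i; lia.
by exists (Ordinal lt); apply: val_inj; rewrite /= hole_val /=; lia.
Qed.

Lemma prolong_rot a b c u v t : prolong a b c t u v = prolong b c a u v t.
Proof.
case: u v t => [x|u] [y|v] [z|t] //=; apply: eq_existsb => i.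
by case: (_ < _)%N => //=; rewrite andbC andbA.
Qed.

(** Stated for all relations pointwise equal to a [prolong], because by
    [prolong_rot] this includes the rotations of a [prolong]. *)
Lemma prolong_fill a b c L' : (forall u v t, L' u v t = prolong a b c u v t) ->
  injective a ->
  (forall i : W, (i < w.+1 - n)%N -> a i + b i + c i = 0) ->
  line_fill both_old L'.
Proof.
move=> LE aI abc [x|u] [y|v] //= _.
- by exists (inr (v + b (hole x))) => -[z|t]; rewrite LE //= subr_eq addrC.
- exists (inr (u - c (hole y))) => -[z|t]; rewrite LE //=.
  by rewrite subr_eq addrC -subr_eq eq_sym.
have [i ai] : exists i, a i = v - u.
  by exists (invF aI (v - u)); rewrite f_invF.
have [lt|[x ix]] := hole_or i.
  exists (inr (v + b i)) => -[z|t]; rewrite LE /=.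
    apply/negP=> /eqP; rewrite -ai => /aI ei.
    by move: lt; rewrite ei hole_val; lia.
  apply/idP/idP => [/existsP[j /and4P[_ /eqP]]|/eqP[->]].
    by rewrite -ai => /aI<- /eqP <- _; rewrite addrC subrK.
  apply/existsP.
  have ci : c i = - (v - u + b i).
    by apply/eqP; rewrite -ai -addr_eq0 addrC abc.
  exists i; rewrite lt ci ai eqxx [v + b i - v]addrAC subrr add0r eqxx /=.
  by rewrite !opprD opprK [- v + u]addrC addrA.
exists (inl x) => -[z|t]; rewrite LE /=.
  by rewrite -ai ix (inj_eq aI) (inj_eq hole_inj) eq_sym.
apply: (@etrans _ _ false) => //.
apply/negbTE/negP=> /existsP[j /and4P[lt /eqP]]; rewrite -ai => /aI ej _.
by move: lt; rewrite -ej ix hole_val; lia.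
Qed.

Definition old_words (E : rel3 X) : rel3 V := fun u v t =>
  match u, v, t with inl x, inl y, inl z => E x y z | _, _, _ => false end.

Lemma prolong_gluing (E : rel3 X) (b c : W -> W) : identifying3 E ->
  injective b -> injective c ->
  (forall i : W, (i < w.+1 - n)%N -> i + b i + c i = 0) ->
  gluing both_old (prolong id b c) (old_words E).
Proof.
move=> Eid bI cI abc; have idI : injective (@id W) by move=> ?.
split.
- by case=> [?|?] [?|?].
- by case=> [?|?] [?|?] [?|?].
- split.
  + exact: (prolong_fill (a := id) (b := b) (c := c)).
  + apply: (prolong_fill (a := b) (b := c) (c := id)) => // [u v t|i lt].
      exact: prolong_rot.
    by rewrite -[RHS](abc i lt) -[RHS]addrA [RHS]addrC.
  + apply: (prolong_fill (a := c) (b := id) (c := b)) => // [u v t|i lt].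
      exact: etrans (prolong_rot _ _ _ _ _ _) (prolong_rot _ _ _ _ _ _).
    by rewrite -[RHS](abc i lt) [RHS]addrC addrA.
- by split; move=> [?|?] [?|?] [?|?].
- by split; move=> [?|?] [?|?] [?|?] [?|?] [?|?].
- by split; move=> [?|?] [?|?] [?|?].
- move=> [x|?] [y|?] [z|?] // _ _.
  have [x' [y' [z' [Ew nw']]]] := id3_cover Eid x y z.
  by exists (inl x'), (inl y'), (inl z').
- move=> [x|?] [y|?] [z|?] [x'|?] [y'|?] [z'|?] // _ _ _ _ _ ag.
  have [|-> -> ->] // := id3_sep Eid (x := x) (y := y) (z := z)
     (x' := x') (y' := y') (z' := z').
  by move=> x0 y0 z0; apply: (ag (inl x0) (inl y0) (inl z0)).
Qed.

End Embed.

Lemma saving_embed n q s : 0 < n -> 2 * n <= q ->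
  saving 'I_n s -> saving 'I_q s.
Proof.
move=> n_gt0 le2n [E Eid]; rewrite card_ord => cardE.
have [w qE] : exists w, q = n + w.+1 by exists (q - n).-1; lia.
have nw : n <= w.+1 by lia.
have [b [c [bI cI bc]]] := near_transversal w.
apply: (@saving_bij ('I_n + 'I_w.+1)%type).
  by rewrite card_sum !card_ord qE.
have G : gluing (@both_old n w) (prolong id b c) (old_words E).
  by apply: prolong_gluing => // i lt; apply: bc; lia.
rewrite -[s]mul1n; apply: (gluing_saving G _ _ cardE).
  pose f (u : 'I_n * 'I_n) : ('I_n + 'I_w.+1) * ('I_n + 'I_w.+1) :=
    (inl u.1, inl u.2).
  have fI : injective f by move=> [x y] [x' y'] [-> ->].
  have -> : 1 * n ^ 2 = #|[set: 'I_n * 'I_n]|.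
    by rewrite cardsT card_prod card_ord mul1n.
  rewrite -(card_imset _ fI); apply: subset_leq_card.
  by apply/subsetP=> p /imsetP[u _ ->]; rewrite inE.
pose f (u : 'I_n * 'I_n * 'I_n) :
    ('I_n + 'I_w.+1) * ('I_n + 'I_w.+1) * ('I_n + 'I_w.+1) :=
  (inl u.1.1, inl u.1.2, inl u.2).
rewrite mul1n; apply: leq_trans (leq_imset_card f _); apply: subset_leq_card.
apply/subsetP=> -[[[x|?] [y|?]] [z|?]]; rewrite inE //= => Ew; apply/imsetP.
by exists (x, y, z); rewrite // inE.
Qed.

(** * Sides that are powers of 4, and conclusion *)

Lemma saving_exp4 t : saving 'I_(4 ^ t.+1) (4 ^ t).
Proof.
elim: t => [|t IH]; first exact: saving4.
have gt0 : 0 < 4 ^ t.+1 by rewrite expn_gt0.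
by have := saving_quadruple gt0 IH; rewrite -!expnS.
Qed.

Theorem corollary24 (t q : nat) :
  1 <= t ->
  2 * 4 ^ t <= q <= 2 * 4 ^ t.+1 - 1 ->
  gamma_ID (@K3 q) <= q ^ 2 - 4 ^ (t - 1).
Proof.
case: t => // t _ /andP[le2q _]; rewrite subn1 /=.
have gt0 : 0 < 4 ^ t.+1 by rewrite expn_gt0.
apply: saving_gamma; first by lia.
exact: saving_embed gt0 le2q (saving_exp4 t).
Qed.
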